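(* Let $d>1$ be a positive integer, $q$ a prime power with $q\equiv 1\pmod d$, and $\omega\in\mathbb{F}_q$ a primitive $d$-th root of unity. For $0\le i\le d-1$ let $$A_i(x)=x^{q^{d-1}}+\omega^i x^{q^{d-2}}+\cdots+\omega^{i(d-1)}x=\sum_{t=0}^{d-1}\omega^{it}x^{q^{d-1-t}}.$$ Let $m_1,\ldots,m_{d-1}$ be positive integers, $u_1,\ldots,u_{d-1}\in\mathbb{F}_q$, and let $g(x)\in\mathbb{F}_q[x]$ be a polynomial. Then the polynomial $$f(x)=g(A_0(x))+\sum_{i=1}^{d-1}u_iA_i(x)^{m_i}$$ is a permutation polynomial of $\mathbb{F}_{q^d}$ if and only if all of the following hold: $\{0\}\cup\{im_i: 1\le i\le d-1\}$ is a complete residue system modulo $d$; $u_1\cdots u_{d-1}\in\mathbb{F}_q^{\ast}$; $\gcd(m_1\cdots m_{d-1},\,q-1)=1$; and $g(x)$ is a permutation polynomial of $\mathbb{F}_q$. Furthermore, if $f(x)$ is a permutation polynomial of $\mathbb{F}_{q^d}$, $r_i$ are positive integers with $m_ir_i\equiv 1\pmod{d(q-1)}$ for $1\le i\le d-1$, and $g^{-1}(x)$ is the compositional inverse of $g(x)$ over $\mathbb{F}_q$, then $$f^{-1}(x)=\frac1d\left(g^{-1}\bigl(A_0(x)/d\bigr)+\sum_{i=1}^{d-1}\omega^i\,(du_i\omega^{-j})^{-r_i}A_{j}(x)^{r_i}\right),$$ where in the $i$-th summand $j=j(i)\in\{1,\ldots,d-1\}$ is the integer with $j\equiv im_i\pmod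 d$.
   Context: $\mathbb{F}_q$ is the finite field with $q$ elements. A polynomial over a finite field $K$ is a permutation polynomial of $K$ if it induces a bijection $K\to K$; its compositional inverse (over $K$) is a polynomial inducing the inverse map. Polynomials over $\mathbb{F}_{q^d}$ are considered as functions on $\mathbb{F}_{q^d}$, i.e. modulo $x^{q^d}-x$, and identities such as the formula for $f^{-1}$ are equalities of functions on $\mathbb{F}_{q^d}$. Likewise $g^{-1}$ is considered modulo $x^q-x$; note that $A_0$ is the trace map from $\mathbb{F}_{q^d}$ to $\mathbb{F}_q$. *)

(* Defs.v *)
From HB Require Import structures.
From mathcomp Require Import all_boot all_order all_algebra all_field.

Set Implicit Arguments.
Unset Strict Implicit.
Unset Printing Implicit Defensive.

Import GRing.Theory.

Local Open Scope ring_scope.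

Definition perm_poly (K : finFieldType) (p : {poly K}) : Prop :=
  bijective (horner p).

(* Polynomials over a finite field are identified with the functions they
   induce, so an inverse is determined only modulo 'X^#|K| - 'X. *)
Definition comp_inverse (K : finFieldType) (p p' : {poly K}) : Prop :=
  cancel (horner p) (horner p') /\ cancel (horner p') (horner p).

(* The list [s] stands for the set of its elements: repetitions in it are
   irrelevant. *)
Definition complete_residue_system (d : nat) (s : seq nat) : Prop :=
  forall a : nat, exists! n : nat, n \in s /\ n = a %[mod d].

Definition A_poly (K : finFieldType) (q d : nat) (w : K) (i : nat) : {poly K} :=
  \sum_(t < d) w ^+ (i * t) *: 'X^(q ^ (d - 1 - t)).

(* Main.v *)
Require Import Defs.
From HB Require Import structures.
From mathcomp Require Import all_boot all_order all_algebra all_fingroup.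
From mathcomp Require Import all_field.
From mathcomp Require Import pgroup.

(** Write sigma for the Frobenius map y |-> y ^+ q of L, and w for the image
    of omega in L.  Since sigma has order d and w is a primitive d-th root of
    unity fixed by sigma, L splits as the direct sum of the eigenspaces
    E_i = { y | sigma y = w ^+ i * y } for 0 <= i < d.  Up to a nonzero scalar
    A_i is the projection onto E_i: it takes its values in E_i
    (frob_eigen_A), it multiplies E_i by d * w ^- i and kills the other
    eigenspaces (A_eigen), and d * x is the sum of the w ^+ i * A_i(x)
    (A_reconstruct).

    The n-th power maps E_i into E_(i * n), so in the coordinates A_i the map
    f reads: the coordinate y_0 goes to g(y_0) in E_0 = F, and y_i goes to
    u_i * y_i ^+ m_i in the eigenspace of index i * m_i mod d (A_f).  Thus f
    merely moves coordinates around, each through a map of one variable.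

    If f is bijective, no eigenspace can be missed, so the residues 0 and
    i * m_i are all the residues mod d (perm_complete_residues).  Restricting
    f to the line E_i shows that u_i <> 0 and that the m_i-th power is
    injective on F (perm_u_neq0, perm_m_coprime), and restricting it to E_0
    shows that g is injective (perm_g).

    Conversely, if the residues are complete then A_k(f(x)), for
    k = i * m_i mod d, depends on y_i only, through its m_i-th power.  As
    nonzero elements of E_i satisfy y ^+ (d * (q - 1)) = 1, that power is
    undone by an exponent r_i inverse to m_i mod d * (q - 1)
    (frob_eigen_expK).  This recovers every coordinate of x from f(x)
    (A_from_f), and reassembling them with A_reconstruct is exactly the
    stated formula for the inverse of f. *)

Set Implicit Arguments.
Unset Strict Implicit.
Unset Printing Implicit Defensive.

Import GRing.Theory.

Local Open Scope ring_scope.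

(** * Residue systems and modular inverses *)

Lemma uniq_map_inj_in (T1 T2 : eqType) (h : T1 -> T2) (s : seq T1) :
  uniq (map h s) -> {in s &, injective h}.
Proof.
elim: s => [|a s IHs] //= /andP[nha us] x y; rewrite !inE.
case/predU1P=> [->|xs] /predU1P[->|ys] // hxy; last exact: IHs.
- by rewrite hxy map_f in nha.
- by rewrite -hxy map_f in nha.
Qed.

(** Pigeonhole: d entries cannot reach all d residues with a repetition. *)
Lemma residue_cover_uniq (d : nat) (s : seq nat) : size s = d ->
    (forall k, (k < d)%N -> k \in [seq (a %% d)%N | a <- s]) ->
  uniq [seq (a %% d)%N | a <- s].
Proof.
move=> sz cov; apply: leq_size_uniq (iota_uniq 0 d) _ _.
  by move=> k; rewrite mem_iota => /cov.
by rewrite size_map size_iota sz.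
Qed.

(** For a list of the right length the uniqueness half of completeness is
    automatic, by the pigeonhole principle. *)
Lemma complete_residue_systemP (d : nat) (s : seq nat) :
    (0 < d)%N -> size s = d ->
  complete_residue_system d s <->
    forall k, (k < d)%N -> k \in [seq (a %% d)%N | a <- s].
Proof.
move=> d0 sz; split=> [crs k kd | cov a].
  have [a [[a_s ak] _]] := crs k.
  by apply/mapP; exists a; rewrite // ak modn_small.
have /mapP[n n_s an] := cov _ (ltn_pmod a d0).
exists n; split=> [|n' [n's na]]; first by rewrite an.
by apply: (uniq_map_inj_in (residue_cover_uniq sz cov)) => //; rewrite na.
Qed.

Lemma coprime_modn_inv (a n : nat) : (0 < a)%N -> coprime a n ->
  exists2 r, (0 < r)%N & a * r = 1 %[mod n].
Proof.
move=> a0 co; case: (egcdnP n a0) => r k e _; exists r.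
  by case: r e => //; rewrite mul0n (eqP co) addn1.
by rewrite mulnC e (eqP co) modnMDl.
Qed.

Lemma coprime_prodl (I : eqType) (s : seq I) (h : I -> nat) (n : nat) :
  coprime (\prod_(i <- s) h i)%N n = all (fun i => coprime (h i) n) s.
Proof.
by elim: s => [|i s IHs]; rewrite ?big_nil ?coprime1n // big_cons coprimeMl IHs.
Qed.

(** A prime p dividing both exponents would give, by Cauchy's theorem, a unit
    of order p, which has the same a-th power as 1. *)
Lemma coprime_expr_inj (F : finFieldType) (a : nat) :
  {in [pred x : F | x != 0] &, injective (fun x => x ^+ a)} ->
  coprime a (#|F| - 1).
Proof.
move=> inj; have Fgt1 := finNzRing_gt1 F.
have n0 : (0 < gcdn a (#|F| - 1))%N by rewrite gcdn_gt0 subn_gt0 Fgt1 orbT.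
rewrite /coprime; apply/eqP; apply: contraTeq isT => n1.
have pr_p : prime (pdiv (gcdn a (#|F| - 1))).
  by apply: pdiv_prime; rewrite ltn_neqAle eq_sym n1.
have := pdiv_dvd (gcdn a (#|F| - 1)); set p := pdiv _ in pr_p *.
rewrite dvdn_gcd => /andP[/dvdnP[k def_a]].
rewrite subn1 -card_finField_unit => p_dvd.
have [x _ ox] := @Cauchy _ p [set: {unit F}]%G pr_p p_dvd.
have xa : val x ^+ a = 1.
  by rewrite -FinRing.val_unitX def_a mulnC expgM -ox expg_order expg1n.
have x1 : val x = 1.
  apply: inj; rewrite ?inE ?oner_neq0 //=; last by rewrite xa expr1n.
  by rewrite -unitfE (valP x).
have /eqP : x = 1%g by apply: val_inj.
by rewrite -order_eq1 ox => /eqP p1; rewrite p1 in pr_p.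
Qed.

(** * Eigenvectors of the Frobenius map *)

Section FrobeniusEigenvectors.

Variables (d q : nat) (F L : finFieldType) (iota : {rmorphism F -> L}).
Variable omega : F.
Hypotheses (hd : (1 < d)%N) (hF : #|F| = q) (hL : #|L| = (q ^ d)%N).
Hypotheses (hqd : q = 1 %[mod d]) (homega : d.-primitive_root omega).

Local Notation w := (iota omega).
Local Notation A i := (horner (A_poly q d w i)).

Definition frob_eigen (k : nat) (y : L) : Prop := y ^+ q = w ^+ k * y.

Let d_gt0 : (0 < d)%N. Proof. exact: ltnW. Qed.

Let w_prim : d.-primitive_root w.
Proof. by rewrite fmorph_primitive_root. Qed.

Let w_unit k : w ^+ k != 0.
Proof.
by rewrite expf_neq0 // (prim_root_eq0 w_prim) -lt0n.
Qed.

Let iota_q (a : F) : iota a ^+ q = iota a.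
Proof. by rewrite -rmorphXn -hF expf_card. Qed.

Let wX_q k : (w ^+ k) ^+ q = w ^+ k.
Proof. by rewrite -rmorphXn iota_q. Qed.

Let q_gt1 : (1 < q)%N.
Proof. by rewrite -hF finNzRing_gt1. Qed.

Let dvd_d_q1 : (d %| q - 1)%N.
Proof. by rewrite -eqn_mod_dvd ?(ltnW q_gt1) //; apply/eqP. Qed.

(** F embeds into L, so q is a power of the characteristic of L; this is what
    makes y |-> y ^+ q additive. *)
Lemma q_pnat : [pchar L].-nat q.
Proof.
have [p pr_p chL] := finPcharP L.
have chF : p \in [pchar F] by rewrite -(fmorph_pchar iota).
by rewrite -hF (card_pprimeChar chF) (eq_pnat _ (pcharf_eq chL)) pnatX pnat_id.
Qed.

Let natd_neq0 : d%:R != 0 :> L. Proof. exact: prim_root_natf_neq0 w_prim. Qed.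

Lemma horner_A i x :
  A i x = \sum_(t < d) w ^+ (i * t) * x ^+ (q ^ (d - 1 - t)).
Proof.
rewrite /A_poly horner_sum; apply: eq_bigr => t _.
by rewrite hornerZ hornerXn.
Qed.

Lemma A_is_additive i x y : A i (x + y) = A i x + A i y.
Proof.
rewrite !horner_A -big_split; apply: eq_bigr => t _ /=.
by rewrite exprDn_pchar ?mulrDr // pnatX q_pnat.
Qed.

Lemma A_scale i (a : F) x : A i (iota a * x) = iota a * A i x.
Proof.
rewrite !horner_A mulr_sumr; apply: eq_bigr => t _.
rewrite exprMn mulrCA; congr (_ * _).
by elim: (_ - t)%N => // n IHn; rewrite expnSr exprM IHn iota_q.
Qed.

Lemma A_zero i : A i 0 = 0.
Proof. by have := A_scale i 0 0; rewrite rmorph0 !mul0r. Qed.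

Lemma A_sum i (s : seq nat) (h : nat -> L) :
  A i (\sum_(k <- s) h k) = \sum_(k <- s) A i (h k).
Proof.
elim: s => [|k s IHs]; first by rewrite !big_nil A_zero.
by rewrite !big_cons A_is_additive IHs.
Qed.

(** Raising to the q-th power shifts the exponents of A_i by one step, and
    the sum is cyclic because x ^+ (q ^ d) = x and w ^+ d = 1. *)
Lemma frob_eigen_A i x : frob_eigen i (A i x).
Proof.
(* As h d = h 0, the sums of h over t < d and over 1 <= t <= d agree. *)
rewrite /frob_eigen; pose h t := w ^+ (i * t) * x ^+ (q ^ (d - t)).
have -> : A i x ^+ q = \sum_(0 <= t < d) h t.
  rewrite horner_A big_mkord.
  elim/big_rec2: _ => [|t a b _ <-]; first by rewrite expr0n gtn_eqF // ltnW.
  rewrite exprDn_pchar ?q_pnat // exprMn wX_q -exprM -expnSr.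
  by rewrite -subnDA add1n subnSK.
have -> : w ^+ i * A i x = \sum_(0 <= t < d) h t.+1.
  rewrite horner_A mulr_sumr big_mkord; apply: eq_bigr => t _.
  by rewrite mulrA -exprD -mulnS /h -subnDA add1n.
have h0d : h 0%N = h d.
  rewrite /h muln0 subn0 subnn expr0 mulnC exprM (prim_expr_order w_prim).
  by rewrite expr1n expn0 expr1 -hL expf_card.
case: d d_gt0 h0d => // n _ h0d.
by rewrite big_nat_recl // big_nat_recr //= h0d addrC.
Qed.

(** On E_k the polynomial A_i is multiplication by a geometric sum in
    w ^+ i / w ^+ k, which is d or 0 according to whether this root of unity
    is trivial. *)
Lemma A_eigen i k y : frob_eigen k y ->
  A i y = if i == k %[mod d] then d%:R * w ^- i * y else 0.
Proof.
move=> yk; have yks s : y ^+ (q ^ s) = w ^+ (k * s) * y.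
  elim: s => [|s IHs]; first by rewrite muln0 mul1r.
  by rewrite expnSr exprM IHs exprMn yk wX_q mulrA -exprD mulnS addnC.
pose z := w ^+ i / w ^+ k.
have -> : A i y = (w ^- k * y) * \sum_(t < d) z ^+ t.
  rewrite horner_A mulr_sumr; apply: eq_bigr => t _.
  rewrite yks mulrA [LHS]mulrC [RHS]mulrAC [RHS]mulrC; congr (_ * _).
  apply: (mulfI (w_unit (k * t.+1))).
  rewrite mulrCA -exprD -mulnDr -subnDA add1n subnKC //.
  rewrite [(k * d)%N]mulnC [w ^+ (d * k)]exprM (prim_expr_order w_prim).
  rewrite expr1n mulr1 exprMn exprVn -!exprM mulnS exprD.
  by rewrite mulrACA divff ?w_unit // mul1r mulrC mulfVK ?w_unit.
rewrite -(eq_prim_root_expr w_prim); case: eqP => [eq_w | neq_w].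
  have -> : z = 1 by rewrite /z eq_w divff ?w_unit.
  under eq_bigr do rewrite expr1n.
  by rewrite sumr_const card_ord eq_w mulrC mulrA.
have z1 : z - 1 != 0.
  rewrite subr_eq0; apply/eqP => z1; apply: neq_w.
  by rewrite -[LHS](mulfVK (w_unit k)) -/z z1 mul1r.
apply/eqP; rewrite mulf_eq0; apply/orP; right.
rewrite -(mulrI_eq0 _ (mulfI z1)) -subrX1 exprMn exprVn -!exprM.
by rewrite ![(_ * d)%N]mulnC !exprM (prim_expr_order w_prim) !expr1n invr1 mulr1
  subrr.
Qed.

(** Summing over i first, orthogonality of the powers of w leaves only the
    term t = d - 1 of the A_i, which is the one of degree 1. *)
Lemma A_reconstruct x : \sum_(0 <= i < d) w ^+ i * A i x = d%:R * x.
Proof.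
have wA i : w ^+ i * A i x =
    \sum_(t < d) w ^+ (i * t.+1) * x ^+ (q ^ (d - 1 - t)).
  rewrite horner_A mulr_sumr; apply: eq_bigr => t _.
  by rewrite mulrA -exprD -mulnS.
under eq_bigr do rewrite wA.
rewrite exchange_big /=.
have geo (t : 'I_d) : \sum_(0 <= i < d) w ^+ (i * t.+1) =
    if t == d.-1 :> nat then d%:R else 0.
  case: eqP => [-> | tn].
    under eq_bigr do
      rewrite prednK // mulnC exprM (prim_expr_order w_prim) expr1n.
    by rewrite big_mkord sumr_const card_ord.
  have z1 : w ^+ t.+1 - 1 != 0.
    rewrite subr_eq0 -[1](expr0 w) (eq_prim_root_expr w_prim).
    rewrite mod0n modn_small // ltn_neqAle ltn_ord andbT.
    by apply/eqP => /(congr1 predn).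
  apply/eqP; rewrite -(mulrI_eq0 _ (mulfI z1)) big_mkord.
  under eq_bigr do rewrite mulnC exprM.
  by rewrite -subrX1 -exprM mulnC exprM (prim_expr_order w_prim) expr1n subrr.
have dn : (d.-1 < d)%N by rewrite prednK.
under eq_bigr do rewrite -mulr_suml geo.
rewrite (bigD1 (Ordinal dn)) //= eqxx subn1 subnn expr1 big1 ?addr0 // => t nt.
by rewrite ifN ?mul0r.
Qed.

Lemma A_joint_inj x y : (forall i, (i < d)%N -> A i x = A i y) -> x = y.
Proof.
move=> eqA; apply: (mulfI natd_neq0); rewrite -!A_reconstruct.
by apply: eq_big_nat => i id; rewrite eqA.
Qed.

Lemma frob_eigen_iota (a : F) : frob_eigen 0 (iota a).
Proof. by rewrite /frob_eigen iota_q mul1r. Qed.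

(** The q elements of F already exhaust the roots of 'X^q - 'X. *)
Lemma frob_eigen0_iota y : frob_eigen 0 y -> exists a, y = iota a.
Proof.
rewrite /frob_eigen mul1r => yq.
have : (map_poly iota ('X^#|F| - 'X)).[y] = 0.
  by rewrite rmorphB /= map_polyXn map_polyX !hornerE hF yq subrr.
rewrite finField_genPoly rmorph_prod horner_prod => /eqP/prodf_eq0[a _].
rewrite rmorphB /= map_polyX map_polyC !hornerE subr_eq0 => /eqP ->.
by exists a.
Qed.

Lemma frob_eigenX k n y : frob_eigen k y -> frob_eigen (k * n) (y ^+ n).
Proof.
by rewrite /frob_eigen -exprM mulnC exprM => ->; rewrite exprMn exprM.
Qed.

Lemma frob_eigen_scale k (a : F) y :
  frob_eigen k y -> frob_eigen k (iota a * y).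
Proof. by rewrite /frob_eigen exprMn iota_q => ->; rewrite mulrCA. Qed.

(** An eigenvector need not lie in F, but its (q - 1)-st power is a power of w, so
    its d * (q - 1)-st power is 1 as soon as it is nonzero. *)
Lemma frob_eigen_expK k y n r : (0 < n)%N -> (0 < r)%N ->
    n * r = 1 %[mod d * (q - 1)] -> frob_eigen k y -> (y ^+ n) ^+ r = y.
Proof.
move=> n0 r0 nr yk; rewrite -exprM.
have [->|y0] := eqVneq y 0; first by rewrite expr0n gtn_eqF // muln_gt0 n0.
have yN : y ^+ (d * (q - 1)) = 1.
  have -> : y ^+ (d * (q - 1)) = (w ^+ k) ^+ d.
    rewrite mulnC exprM; congr (_ ^+ d); apply: (mulIf y0).
    by rewrite -exprSr subn1 prednK ?(ltnW q_gt1).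
  by rewrite -exprM mulnC exprM (prim_expr_order w_prim) expr1n.
by rewrite -(expr_mod _ yN) nr expr_mod.
Qed.

(** A_i has values in E_i, and its degree q ^ (d - 1) is too small for it to
    vanish on all of L. *)
Lemma frob_eigen_neq0 i : exists2 y, frob_eigen i y & y != 0.
Proof.
pose P := A_poly q d w i.
have coefP : P`_(q ^ (d - 1)) = 1.
  rewrite /P /A_poly coef_sum (bigD1 (Ordinal d_gt0)) //= muln0 subn0 scale1r.
  rewrite coefXn eqxx big1 ?addr0 // => t t0.
  rewrite coefZ coefXn eqn_exp2l // gtn_eqF ?mulr0 //.
  by rewrite ltn_subrL lt0n t0 subn_gt0.
have P0 : P != 0.
  by apply: contra_eq_neq coefP => ->; rewrite coef0 eq_sym oner_neq0.
have [|/existsPn allz] := boolP [exists x, A i x != 0].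
  by case/existsP=> x nz; exists (A i x) => //; exact: frob_eigen_A.
have := max_poly_roots P0 _ (enum_uniq L).
rewrite -cardE hL => /(_ _)/wrap[|].
  by apply/allP => x _; have := allz x; rewrite negbK.
rewrite ltnNge => /negP[]; apply: leq_trans (size_sum _ _ _) _.
apply/bigmax_leqP => t _; apply: leq_trans (size_scale_leq _ _) _.
by rewrite size_polyXn ltn_exp2l // -subnDA ltn_subrL.
Qed.


(** * The map f in eigenspace coordinates *)

Section PermutationPolynomial.

Variables (m : nat -> nat) (u : nat -> F) (g : {poly F}).
Hypothesis hm : forall i : nat, (1 <= i < d)%N -> (0 < m i)%N.

Local Notation f := ((map_poly iota g \Po A_poly q d w 0%N) +
  \sum_(1 <= i < d) iota (u i) *: A_poly q d w i ^+ m i).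

Lemma horner_f x : f.[x] =
  (map_poly iota g).[A 0 x] + \sum_(1 <= i < d) iota (u i) * A i x ^+ m i.
Proof.
rewrite hornerD horner_comp; congr (_ + _); rewrite horner_sum.
by apply: eq_bigr => i _; rewrite hornerZ horner_exp.
Qed.

(** Only those summands of f that lie in E_k contribute to A_k(f(x)). *)
Lemma A_f k x a : A 0 x = iota a ->
  A k f.[x] = (if k == 0 %[mod d] then d%:R * w ^- k * iota g.[a] else 0)
    + \sum_(1 <= i < d) (if k == i * m i %[mod d]
                         then d%:R * w ^- k * (iota (u i) * A i x ^+ m i)
                         else 0).
Proof.
move=> A0x; rewrite horner_f A0x horner_map A_is_additive A_sum.
rewrite (A_eigen k (frob_eigen_iota _)); congr (_ + _); apply: eq_bigr => i _.
exact: A_eigen (frob_eigen_scale _ (frob_eigenX _ (frob_eigen_A i x))).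
Qed.

Lemma f_iota (a : F) : f.[iota a] = iota g.[d%:R * a].
Proof.
have Aia := A_eigen _ (frob_eigen_iota a).
rewrite horner_f Aia eqxx invr1 mulr1 -(rmorph_nat iota) -rmorphM horner_map.
rewrite big_nat big1 ?addr0 // => i /[dup] /hm mi /andP[i0 id].
by rewrite Aia mod0n modn_small // gtn_eqF // expr0n gtn_eqF // mulr0.
Qed.

Lemma f_eigen i y : (1 <= i < d)%N -> frob_eigen i y ->
  f.[y] = iota g.[0] + iota (u i) * (d%:R * w ^- i * y) ^+ m i.
Proof.
move=> i1d yi; have Aiy k := A_eigen k yi; have /andP[i0 id] := i1d.
rewrite horner_f Aiy mod0n modn_small // ltn_eqF //; congr (_ + _).
  by rewrite -[X in _.[X]](rmorph0 iota) horner_map.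
rewrite (bigD1_seq i) ?iota_uniq ?mem_index_iota //=.
rewrite Aiy eqxx big_nat_cond big1 ?addr0 // => k /andP[k1d ki].
have /andP[_ kd] := k1d.
by rewrite Aiy !modn_small // (negPf ki) expr0n gtn_eqF ?hm // mulr0.
Qed.

Local Notation residues := (0%N :: [seq (i * m i)%N | i <- index_iota 1 d]).

Lemma size_residues : size residues = d.
Proof. by rewrite /= size_map size_iota subn1 prednK. Qed.

(** * Necessity of the conditions *)

Section Necessity.

Hypothesis f_perm : perm_poly f.

Let f_inj : injective (horner f). Proof. exact: bij_inj. Qed.

(** Otherwise f would be constant on E_i, which has a nonzero element. *)
Lemma perm_u_neq0 i : (1 <= i < d)%N -> u i != 0.
Proof.
move=> i1d; have [y yi] := frob_eigen_neq0 i; apply: contra_neq => ui.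
have zi : frob_eigen i 0 by rewrite /frob_eigen mulr0 expr0n gtn_eqF // ltnW.
by apply: f_inj; rewrite !(f_eigen i1d) // ui rmorph0 !mul0r.
Qed.

(** On the line spanned over F by an eigenvector y, f is an affine function
    of a ^+ m i, where a * y is the point of the line. *)
Lemma perm_m_coprime i : (1 <= i < d)%N -> coprime (m i) (q - 1).
Proof.
move=> i1d; rewrite -hF; apply: coprime_expr_inj => a b _ _ ab.
have [y yi y0] := frob_eigen_neq0 i.
apply: (fmorph_inj iota); apply: (mulIf y0); apply: f_inj.
rewrite (f_eigen i1d (frob_eigen_scale a yi)).
rewrite (f_eigen i1d (frob_eigen_scale b yi)).
by rewrite !(mulrCA _ (iota _) y) !exprMn -!rmorphXn /= ab.
Qed.

(** f acts on F as a |-> g(d * a), and d is invertible. *)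
Lemma perm_g : perm_poly g.
Proof.
have dF : d%:R != 0 :> F by rewrite (prim_root_natf_neq0 homega).
apply: injF_bij => a b gab.
rewrite -[a](mulVKf dF) -[b](mulVKf dF); congr (_ * _).
apply: (fmorph_inj iota); apply: f_inj.
by rewrite !f_iota !mulVKf // gab.
Qed.

(** If no i * m i is congruent to k, then A_k vanishes on the image of f,
    hence on L by surjectivity, although it is nonzero on E_k. *)
Lemma perm_complete_residues : complete_residue_system d residues.
Proof.
apply/(complete_residue_systemP d_gt0 size_residues) => k kd /=.
rewrite inE mod0n; case: eqP => //= /eqP k0; apply: contraT => nk.
have Ak0 y : A k y = 0.
  have [f' _ ff'] := f_perm; rewrite -[y]ff'; set x := f' y.
  have [a A0x] := frob_eigen0_iota (frob_eigen_A 0 x).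
  rewrite (A_f k A0x) mod0n modn_small // (negPf k0) add0r.
  rewrite big_nat big1 // => i i1d; case: eqP => // kim; case/negP: nk.
  apply/mapP; exists (i * m i)%N; last exact: kim.
  by apply: (map_f (fun i => i * m i)%N); rewrite mem_index_iota.
have [y yk /eqP[]] := frob_eigen_neq0 k.
apply: (mulfI (mulf_neq0 natd_neq0 (invr_neq0 (w_unit k)))).
by have := A_eigen k yk; rewrite eqxx Ak0 mulr0 => <-.
Qed.

End Necessity.

(** * Sufficiency of the conditions and the inverse map *)

Section Sufficiency.

Hypothesis crs : complete_residue_system d residues.

Let residues_uniq : uniq [seq (a %% d)%N | a <- residues].
Proof.
apply: residue_cover_uniq size_residues _.
exact/(complete_residue_systemP d_gt0 size_residues).
Qed.

Lemma residue_neq0 i : (1 <= i < d)%N -> (i * m i %% d)%N != 0%N.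
Proof.
move=> i1d; have /andP[+ _] := residues_uniq; rewrite mod0n.
apply: contra => /eqP im0; rewrite -[X in X \in _]im0; apply: map_f.
by apply: (map_f (fun i => i * m i)%N); rewrite mem_index_iota.
Qed.

Lemma residue_inj i k : (1 <= i < d)%N -> (1 <= k < d)%N ->
  i * m i = k * m k %[mod d] -> i = k.
Proof.
have : uniq [seq (i * m i %% d)%N | i <- index_iota 1 d].
  by have := residues_uniq; rewrite map_cons cons_uniq -map_comp => /andP[].
by move=> /uniq_map_inj_in inj ? ? /inj; apply; rewrite mem_index_iota.
Qed.

Lemma A0_f x a : A 0 x = iota a -> A 0 f.[x] = d%:R * iota g.[a].
Proof.
move=> A0x; rewrite (A_f 0 A0x) eqxx invr1 mulr1 big_nat big1 ?addr0 //.
by move=> i i1d; rewrite mod0n eq_sym (negPf (residue_neq0 i1d)).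
Qed.

Lemma Aj_f i k x : (1 <= i < d)%N -> (1 <= k < d)%N -> k = i * m i %[mod d] ->
  A k f.[x] = d%:R * iota (u i) * w ^- k * A i x ^+ m i.
Proof.
move=> i1d /andP[k0 kd] kim.
have [a A0x] := frob_eigen0_iota (frob_eigen_A 0 x).
rewrite (A_f k A0x) mod0n [(k %% d)%N in X in X + _]modn_small //.
rewrite gtn_eqF // add0r.
rewrite (bigD1_seq i) ?iota_uniq ?mem_index_iota //= kim eqxx.
rewrite big_nat_cond big1 ?addr0 => [|l /andP[l1d li]].
  by rewrite -!mulrA; congr (_ * _); rewrite mulrCA.
by case: eqP => // /(residue_inj i1d l1d) il; rewrite il eqxx in li.
Qed.

(** This is the summand of index i of the formula for the inverse of f, up to
    the factor w ^+ i / d. *)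
Lemma A_from_f i k r x : (1 <= i < d)%N -> (1 <= k < d)%N ->
    k = i * m i %[mod d] -> u i != 0 -> (0 < r)%N ->
    m i * r = 1 %[mod d * (q - 1)] ->
  (d%:R * iota (u i) * w ^- k) ^- r * A k f.[x] ^+ r = A i x.
Proof.
move=> i1d k1d kim ui r0 mr; rewrite (Aj_f x i1d k1d kim).
rewrite [(_ * A i x ^+ _) ^+ r]exprMn mulKf.
  exact: frob_eigen_expK (hm i1d) r0 mr (frob_eigen_A i x).
by rewrite expf_neq0 // !mulf_neq0 ?invr_neq0 ?w_unit ?fmorph_eq0.
Qed.

(** Coprimality of m i to q - 1 suffices to invert m i mod d * (q - 1), since
    d divides q - 1. *)
Lemma perm_f : (forall i, (1 <= i < d)%N -> u i != 0) ->
  (forall i, (1 <= i < d)%N -> coprime (m i) (q - 1)) ->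
  perm_poly g -> perm_poly f.
Proof.
move=> u_neq0 m_co g_perm; apply: injF_bij => x y fxy.
apply: A_joint_inj => -[_|i id].
  have [a A0x] := frob_eigen0_iota (frob_eigen_A 0 x).
  have [b A0y] := frob_eigen0_iota (frob_eigen_A 0 y).
  rewrite A0x A0y; congr (iota _); apply: (bij_inj g_perm).
  apply: (fmorph_inj iota); apply: (mulfI natd_neq0).
  by rewrite -(A0_f A0x) -(A0_f A0y) fxy.
have i1d : (1 <= i.+1 < d)%N by [].
have m_co_N : coprime (m i.+1) (d * (q - 1)).
  by rewrite coprimeMr m_co // andbT (coprime_dvdr dvd_d_q1) ?m_co.
have [r r0 mr] := coprime_modn_inv (hm i1d) m_co_N.
pose k := (i.+1 * m i.+1 %% d)%N.
have k1d : (1 <= k < d)%N by rewrite lt0n residue_neq0 // ltn_pmod.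
have kim : k = i.+1 * m i.+1 %[mod d] by rewrite modn_mod.
by rewrite -!(A_from_f _ i1d k1d kim (u_neq0 _ i1d) r0 mr) fxy.
Qed.

End Sufficiency.

End PermutationPolynomial.

End FrobeniusEigenvectors.

(** * The permutation criterion and the inverse formula *)

Theorem theorem4p1 (d q : nat) (F L : finFieldType) (iota : {rmorphism F -> L})
    (omega : F) (m : nat -> nat) (u : nat -> F) (g : {poly F})
    (hd : (1 < d)%N)
    (hF : #|F| = q)
    (hL : #|L| = (q ^ d)%N)
    (hqd : q = 1 %[mod d])
    (homega : d.-primitive_root omega)
    (hm : forall i : nat, (1 <= i < d)%N -> (0 < m i)%N) :
  let A := A_poly q d (iota omega) in
  let f : {poly L} :=
    (map_poly iota g \Po A 0%N) +
    \sum_(1 <= i < d) iota (u i) *: A i ^+ m i in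
  (perm_poly f <->
    [/\ complete_residue_system d
          (0%N :: [seq (i * m i)%N | i <- index_iota 1 d]),
        \prod_(1 <= i < d) u i != 0,
        gcdn (\prod_(1 <= i < d) m i)%N (q - 1)%N = 1%N
      & perm_poly g]) /\
  (perm_poly f ->
   forall (r j : nat -> nat) (ginv : {poly F}),
     (forall i : nat, (1 <= i < d)%N ->
        (0 < r i)%N /\ m i * r i = 1 %[mod d * (q - 1)]) ->
     (forall i : nat, (1 <= i < d)%N ->
        (1 <= j i < d)%N /\ j i = i * m i %[mod d]) ->
     comp_inverse g ginv ->
     comp_inverse f
       (d%:R^-1 *:
          ((map_poly iota ginv \Po (d%:R^-1 *: A 0%N)) +
           \sum_(1 <= i < d)
             (iota omega ^+ i
              * (d%:R * iota (u i) * iota omega ^- j i) ^- r i)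
             *: A (j i) ^+ r i))).
Proof.
move=> A f; have d_gt0 := ltnW hd.
have prod_u : (\prod_(1 <= i < d) u i != 0) <->
    (forall i, (1 <= i < d)%N -> u i != 0).
  rewrite prodf_seq_neq0; split=> [/allP u0 i i1d | u0].
    by apply: u0; rewrite mem_index_iota.
  by apply/allP => i; rewrite mem_index_iota; apply: u0.
have prod_m : gcdn (\prod_(1 <= i < d) m i) (q - 1) = 1%N <->
    (forall i, (1 <= i < d)%N -> coprime (m i) (q - 1)).
  split=> [/eqP | m_co]; last first.
    apply/eqP; rewrite -/(coprime _ _) coprime_prodl.
    by apply/allP => i; rewrite mem_index_iota; apply: m_co.
  rewrite -/(coprime _ _) coprime_prodl => /allP m_co i i1d.
  by apply: m_co; rewrite mem_index_iota.
have necessary : perm_poly f -> [/\ complete_residue_system d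
          (0%N :: [seq (i * m i)%N | i <- index_iota 1 d]),
        \prod_(1 <= i < d) u i != 0,
        gcdn (\prod_(1 <= i < d) m i)%N (q - 1)%N = 1%N
      & perm_poly g].
  move=> fP; split.
  - exact: (perm_complete_residues hd hF hL homega fP).
  - exact/prod_u/(perm_u_neq0 hd hF hL homega hm fP).
  - exact/prod_m/(perm_m_coprime hd hF hL homega hm fP).
  - exact: (perm_g hd hF homega hm fP).
split; first split=> // -[crs /prod_u u0 /prod_m m_co gP].
  exact: perm_f.
move=> fP r j ginv r_inv j_res [gK _].
have [crs /prod_u u0 _ _] := necessary fP.
set h := _ *: _.
(* L is finite and f bijective, so a left inverse is two-sided. *)
suff fK : cancel (horner f) (horner h) by split=> //; apply/(bij_can_sym fP).
move=> x; have d0 : d%:R != 0 :> L.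
  apply: (@prim_root_natf_neq0 _ _ (iota omega)).
  by rewrite fmorph_primitive_root.
apply: (mulfI d0); rewrite -(A_reconstruct q iota hd homega x).
rewrite hornerZ mulVKf // hornerD [RHS]big_ltn //; congr (_ + _).
  rewrite horner_comp hornerZ.
  have A0_fixed := frob_eigen_A iota hd hF hL homega 0 x.
  have [a A0x] := frob_eigen0_iota hF A0_fixed.
  by rewrite (A0_f hd hF hL homega u g crs A0x) mulKf // horner_map gK A0x
    mul1r.
rewrite horner_sum; apply: eq_big_nat => i i1d.
have [r0 mr] := r_inv i i1d; have [j1d jim] := j_res i i1d.
rewrite hornerZ horner_exp -[LHS]mulrA; congr (_ * _).
exact: (A_from_f iota hd hF hL homega g hm crs x i1d j1d jim (u0 i i1d) r0 mr).
Qed.
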